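(* The complex $(\widetilde{C}^-(G),\widetilde{\partial}^-)$ of a grid diagram of complexity $n$ induces a sign assignment. Precisely, for all $(\mathbf{x},\mathbf{y})\in\mathfrak{S}_n^2$ and all $r\in\mathrm{Rect}^\circ(\mathbf{x},\mathbf{y})$ set $$\mathbf{S}(r)=\varepsilon(r)\cdot c(\mathbf{x}^{-1}.\mathbf{y},\mathbf{x}),$$ where $\varepsilon(r)=+1$ if $r$ is not horizontally torn and $\varepsilon(r)=-1$ otherwise. Then $\mathbf{S}:\mathrm{Rect}^\circ\to\{\pm1\}$ is a sign assignment.
   Context: Groups. $\mathfrak{S}_n$ is the group of bijections of $\{0,\dots,n-1\}$, with product $(x.y)(i)=x(y(i))$, $\tau_{i,j}$ is the transposition of $i$ and $j$ ($\tau_{i,i}=1$), and $\tau_i=\tau_{i,i+1}$. $\widetilde{\mathfrak{S}}_n$ is the group with generators $\widetilde{\tau}_0,\dots,\widetilde{\tau}_{n-2},z$ and relations $z^2=1$, $z\widetilde{\tau}_i=\widetilde{\tau}_iz$, $\widetilde{\tau}_i^2=z$, $\widetilde{\tau}_i\widetilde{\tau}_j=z\widetilde{\tau}_j\widetilde{\tau}_i$ for $|i-j|>1$, $\widetilde{\tau}_i\widetilde{\tau}_{i+1}\widetilde{\tau}_i=\widetilde{\tau}_{i+1}\widetilde{\tau}_i\widetilde{\tau}_{i+1}$. It is a central extension of $\mathfrak{S}_n$ by $\{1,z\}\cong\mathbb{Z}/2\mathbb{Z}$ via $p:\widetilde{\tau}_i\mapsto\tau_i$, $z\mapsto1$. For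 $i<j$ put $\widetilde{\tau}_{i,j}=\widetilde{\tau}_i\widetilde{\tau}_{i+1}\cdots\widetilde{\tau}_{j-2}\widetilde{\tau}_{j-1}\widetilde{\tau}_{j-2}\cdots\widetilde{\tau}_{i+1}\widetilde{\tau}_i$, $\widetilde{\tau}_{j,i}=z\widetilde{\tau}_{i,j}$, and $\widetilde{\tau}_{i,i}=1$. The section $s$ and cocycle $c$. Every $\mathbf{x}\in\mathfrak{S}_n$ is written uniquely as $\mathbf{x}=\tau_{i_0,0}.\tau_{i_1,1}.\cdots.\tau_{i_{n-1},n-1}$ with $0\le i_k\le k$ (here $\mathbf{x}(i_{n-1})=n-1$, and one continues inductively with $\mathbf{x}.\tau_{i_{n-1},n-1}$, which fixes $n-1$ and is viewed in $\mathfrak{S}_{n-1}$). Set $s(\mathbf{x})=\widetilde{\tau}_{i_0,0}.\widetilde{\tau}_{i_1,1}.\cdots.\widetilde{\tau}_{i_{n-1},n-1}\in\widetilde{\mathfrak{S}}_n$; then $p\circ s=\mathrm{id}$ and $s(\tau_{i,j})=\widetilde{\tau}_{i,j}$ for $i<j$. The 2-cocycle $c:\mathfrak{S}_n\times\mathfrak{S}_n\to\{\pm1\}$ is defined by $s(\mathbf{x}).s(\mathbf{y})=\iota(c(\mathbf{x},\mathbf{y}))\,s(\mathbf{x}.\mathbf{y})$, where $\iota(1)=1$, $\iota(-1)=z$. Rectangles. Let $\mathcal{T}$ be the oriented torus obtained from the square $[0,n]\times[0,n]$ by identifying opposite sides. $\mathbf{x}\in\mathfrak{S}_n$ is identified with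 the set of points $(i,\mathbf{x}(i))$, $0\le i\le n-1$. For $\mathbf{x}\in\mathfrak{S}_n$ and an ordered pair $i\ne j$, there is a rectangle $r$ from $\mathbf{x}$ to $\mathbf{y}=\mathbf{x}.\tau_{i,j}$, embedded in $\mathcal{T}$ with bottom left corner $(i,\mathbf{x}(i))$ and top right corner $(j,\mathbf{x}(j))$ (going rightwards from column $i$ to column $j$ and upwards from $\mathbf{x}(i)$ to $\mathbf{x}(j)$, cyclically). These are all the rectangles from $\mathbf{x}$ to $\mathbf{y}$. It is empty if its interior contains no point of $\mathbf{x}$; $\mathrm{Rect}^\circ(\mathbf{x},\mathbf{y})$ is the set of empty rectangles from $\mathbf{x}$ to $\mathbf{y}$, and $\mathrm{Rect}^\circ$ is the disjoint union of these sets over all $(\mathbf{x},\mathbf{y})$ (so a rectangle remembers the generators it connects). A rectangle is horizontally torn if the first coordinate (in $\{0,\dots,n-1\}$) of its bottom left corner is larger than that of its top right corner. For $r_1\in\mathrm{Rect}^\circ(\mathbf{x},\mathbf{y})$ and $r_2\in\mathrm{Rect}^\circ(\mathbf{y},\mathbf{z})$, $r_1*r_2$ denotes their juxtaposition: the domain from $\mathbf{x}$ to $\mathbf{z}$ whose underlying 2-chain in $\mathcal{T}$ is the sum of those of $r_1$ and $r_2$. Sign assignment. A sign assignment is a function $\mathbf{S}:\mathrm{Rect}^\circ\to\{\pm1\}$ such that: (Sq) for any distinct $r_1,r_2,r_1',r_2'\in\mathrm{Rect}^\circ$ with $r_1*r_2=r_1'*r_2'$, $\mathbf{S}(r_1)\mathbf{S}(r_2)=-\mathbf{S}(r_1')\mathbf{S}(r_2')$;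 (V) if $r_1,r_2\in\mathrm{Rect}^\circ$ are such that $r_1*r_2$ is a vertical annulus then $\mathbf{S}(r_1)\mathbf{S}(r_2)=-1$; (H) if $r_1,r_2\in\mathrm{Rect}^\circ$ are such that $r_1*r_2$ is a horizontal annulus then $\mathbf{S}(r_1)\mathbf{S}(r_2)=+1$. The complex mentioned. For a grid diagram $G$ of complexity $n$ with $O$-markings $O_1,\dots,O_n$ (one in each row and each column, at centres of unit squares), $\widetilde{C}^-(G)$ is the free $\mathbb{Z}[U_{O_1},\dots,U_{O_n}]$-module on $\widetilde{\mathfrak{S}}_n$ modulo the submodule generated by $z+1$, and $\widetilde{\partial}^-\widetilde{\mathbf{x}}$ is the sum, over the ordered pairs $i\ne j$ for which the rectangle $r$ determined by $p(\widetilde{\mathbf{x}})$ and $(i,j)$ is empty, of $U_{O_1}^{O_1(r)}\cdots U_{O_n}^{O_n(r)}\,\widetilde{\mathbf{x}}.\widetilde{\tau}_{i,j}$, where $O_k(r)$ is the number of times $O_k$ appears in the interior of $r$.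
   Formalization: The arguments of the cocycle are interchanged: S(r) = ε(r)·c(x, x^{-1}.y) instead of ε(r)·c(x^{-1}.y, x); as printed the formula violates (V) for n = 3, x = τ_0 and the vertical annulus on columns (2,0). *)

(* Defs.v *)
From HB Require Import structures.
From mathcomp Require Import all_boot all_order all_algebra all_fingroup.
From mathcomp Require Import generic_quotient boolp classical_sets.

Set Implicit Arguments.
Unset Strict Implicit.
Unset Printing Implicit Defensive.

Import GRing.Theory.

(* Written with MathComp, plus the classical layer of MathComp-Analysis. *)

(** * Groups given by generators and relations *)

Section Presentation.
Variable A : choiceType.

(* The letter (a, false) stands for the generator a, (a, true) for its formal
   inverse. *)
Definition gword := seq (A * bool).

Definition gword_inv (u : gword) : gword :=
  rev [seq (l.1, ~~ l.2) | l <- u].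

Definition gword_of (s : seq A) : gword := [seq (a, false) | a <- s].

(* [rel u v] is read as the relation u = v between positive words. *)
Variable rel : seq A -> seq A -> Prop.

Inductive gword_eqv : gword -> gword -> Prop :=
| gword_rel u v of rel u v : gword_eqv (gword_of u) (gword_of v)
| gword_cancel a b : gword_eqv [:: (a, b); (a, ~~ b)] [::]
| gword_refl u : gword_eqv u u
| gword_sym u v of gword_eqv u v : gword_eqv v u
| gword_trans u v w of gword_eqv u v & gword_eqv v w : gword_eqv u w
| gword_cat u u' v v' of gword_eqv u u' & gword_eqv v v' :
    gword_eqv (u ++ v) (u' ++ v').

Definition gword_eqvb (u v : gword) : bool := `[< gword_eqv u v >].

Fact gword_eqvb_refl : reflexive gword_eqvb.
Proof. by move=> u; apply/asboolP; exact: gword_refl. Qed.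

Fact gword_eqvb_sym : symmetric gword_eqvb.
Proof. by move=> u v; apply/asboolP/asboolP; exact: gword_sym. Qed.

Fact gword_eqvb_trans : transitive gword_eqvb.
Proof.
by move=> v u w /asboolP uv /asboolP vw; apply/asboolP; exact: gword_trans vw.
Qed.

Canonical gword_equiv :=
  EquivRel gword_eqvb gword_eqvb_refl gword_eqvb_sym gword_eqvb_trans.

Definition presented : Type := {eq_quot gword_equiv}%qT.

HB.instance Definition _ := Choice.on presented.
HB.instance Definition _ := EqQuotient.on presented.

Local Open Scope quotient_scope.

Definition presented_pi (u : gword) : presented := \pi_presented u.

Definition presented_gen (a : A) : presented := presented_pi [:: (a, false)].

Definition presented_mul (x y : presented) : presented :=
  presented_pi (repr x ++ repr y).

Definition presented_inv (x : presented) : presented :=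
  presented_pi (gword_inv (repr x)).

Lemma presented_piP u v :
  gword_eqv u v <-> presented_pi u = presented_pi v.
Proof.
split=> [uv|/eqmodP/asboolP //].
by apply/eqmodP; apply/asboolP.
Qed.

Lemma gword_eqv_repr u : gword_eqv (repr (presented_pi u)) u.
Proof. by apply/presented_piP; rewrite /presented_pi reprK. Qed.

Lemma presented_mulE u v :
  presented_mul (presented_pi u) (presented_pi v) = presented_pi (u ++ v).
Proof.
by apply/presented_piP; apply: gword_cat; exact: gword_eqv_repr.
Qed.

Lemma gword_invV u : gword_eqv (gword_inv u ++ u) [::].
Proof.
elim: u => [|[a b] u IH]; first exact: gword_refl.
rewrite /gword_inv /= rev_cons cat_rcons -/(gword_inv u).
apply: gword_trans IH; apply: gword_cat; first exact: gword_refl.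
apply: (@gword_cat [:: (a, ~~ b); (a, b)] [::] u u); last exact: gword_refl.
by rewrite -{2}[b]negbK; exact: gword_cancel.
Qed.

Lemma gword_invK : involutive gword_inv.
Proof.
move=> u; rewrite /gword_inv map_rev revK -map_comp -[RHS]map_id.
by apply: eq_map => -[a b] /=; rewrite negbK.
Qed.

Lemma gword_Vinv u : gword_eqv (u ++ gword_inv u) [::].
Proof. by rewrite -{1}[u]gword_invK; exact: gword_invV. Qed.

Lemma presented_reprK x : presented_pi (repr x) = x.
Proof. exact: reprK. Qed.

Fact presented_mulA : associative presented_mul.
Proof.
move=> x y z; rewrite -[x]presented_reprK -[y]presented_reprK.
by rewrite -[z]presented_reprK !presented_mulE catA.
Qed.

Fact presented_mul1 : left_id (presented_pi [::]) presented_mul.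
Proof. by move=> x; rewrite -[x]presented_reprK presented_mulE. Qed.

Fact presented_mulr1 : right_id (presented_pi [::]) presented_mul.
Proof. by move=> x; rewrite -[x]presented_reprK presented_mulE cats0. Qed.

Fact presented_mulV :
  left_inverse (presented_pi [::]) presented_inv presented_mul.
Proof.
move=> x; rewrite /presented_inv -{2}[x]presented_reprK presented_mulE.
by apply/presented_piP; exact: gword_invV.
Qed.

Fact presented_mulrV :
  right_inverse (presented_pi [::]) presented_inv presented_mul.
Proof.
move=> x; rewrite /presented_inv -{1}[x]presented_reprK presented_mulE.
by apply/presented_piP; exact: gword_Vinv.
Qed.

HB.instance Definition _ := isGroup.Build presented
  presented_mulA presented_mul1 presented_mulr1 presented_mulV presented_mulrV.

Lemma presented_rel u v : rel u v ->
  (\prod_(a <- u) presented_gen a = \prod_(a <- v) presented_gen a)%g.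
Proof.
move=> uv.
have E s : (\prod_(a <- s) presented_gen a)%g = presented_pi (gword_of s).
  elim: s => [|a s IH]; first by rewrite big_nil.
  by rewrite big_cons IH; exact: presented_mulE.
by rewrite !E; apply/presented_piP; exact: gword_rel.
Qed.

End Presentation.

(** * The symmetric group and its spin extension *)

(* [perm] multiplies permutations in the opposite order: (x * y) i = y (x i). *)
Definition pcomp n (x y : 'S_n) : 'S_n := (y * x)%g.

Lemma pcompE n (x y : 'S_n) i : pcomp x y i = x (y i).
Proof. by rewrite permM. Qed.

(* The generators are z = None and the Some i with 0 <= i <= n - 2. *)
Inductive spin_rel n : seq (option 'I_n.-1) -> seq (option 'I_n.-1) -> Prop :=
| spin_zz : spin_rel [:: None; None] [::]
| spin_zt i : spin_rel [:: None; Some i] [:: Some i; None]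
| spin_tt i : spin_rel [:: Some i; Some i] [:: None]
| spin_far (i j : 'I_n.-1) of (i.+1 < j) || (j.+1 < i) :
    spin_rel [:: Some i; Some j] [:: None; Some j; Some i]
| spin_braid (i j : 'I_n.-1) of j = i.+1 :> nat :
    spin_rel [:: Some i; Some j; Some i] [:: Some j; Some i; Some j].

Definition spin n : groupType := presented (@spin_rel n).

Definition spin_z n : spin n := presented_gen (@spin_rel n) None.

(* Equal to 1 outside the range 0 <= k <= n - 2, which is never used. *)
Definition spin_t n (k : nat) : spin n :=
  if insub k is Some i then presented_gen (@spin_rel n) (Some i) else 1%g.

(* The word i, i + 1, ..., j - 2, j - 1, j - 2, ..., i + 1, i for i < j. *)
Definition spin_tau_lt n (i j : nat) : spin n :=
  (\prod_(k <- iota i (j - i) ++ rev (iota i (j - i).-1)) spin_t n k)%g.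

Definition spin_tau n (i j : 'I_n) : spin n :=
  if i < j then spin_tau_lt n i j
  else if j < i then (spin_z n * spin_tau_lt n j i)%g
  else 1%g.

Definition is_factorization n (x : 'S_n) (f : {ffun 'I_n -> 'I_n}) : bool :=
  [forall k, f k <= k] && (x == \big[@pcomp n/1%g]_(k < n) tperm (f k) k).

(* Every x has exactly one factorization, so the None case is void. *)
Definition sec n (x : 'S_n) : spin n :=
  if [pick f | is_factorization x f] is Some f
  then (\prod_(k < n) spin_tau (f k) k)%g else 1%g.

Local Open Scope ring_scope.

Definition is_sign (e : int) : Prop := e = 1 \/ e = -1.

Definition sign_spin n (e : int) : spin n :=
  if e == -1 then spin_z n else 1%g.

(* The sign is unique because z <> 1, and exists because the kernel of
   spin n -> 'S_n is {1, z}. *)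
Definition cocycle n (x y : 'S_n) : int :=
  xget 1 (fun e => is_sign e /\
    (sec x * sec y)%g = (sign_spin n e * sec (pcomp x y))%g).

(** * Empty rectangles on the torus *)

Definition cyc_dist n (a k : 'I_n) : nat := ((k + (n - a)) %% n)%N.

(* The unit segment [k, k + 1] lies on the arc going up from a to b. *)
Definition in_arc n (a b k : 'I_n) : bool := (cyc_dist a k < cyc_dist a b)%N.

(* The point k lies in the interior of the arc going up from a to b. *)
Definition in_open_arc n (a b k : 'I_n) : bool :=
  (0 < cyc_dist a k < cyc_dist a b)%N.

(* (x, (i, j)) is the rectangle from x to x.tau_{i,j} with bottom left corner
   (i, x i) and top right corner (j, x j). *)
Definition empty_rect n (r : 'S_n * ('I_n * 'I_n)) : bool :=
  let: (x, (i, j)) := r in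
  (i != j) &&
  [forall k, ~~ (in_open_arc i j k && in_open_arc (x i) (x j) (x k))].

Definition rect n := {r : 'S_n * ('I_n * 'I_n) | empty_rect r}.

Section Rectangles.
Variables (n : nat) (r : rect n).

Definition rsrc : 'S_n := (val r).1.
Definition rleft : 'I_n := (val r).2.1.
Definition rright : 'I_n := (val r).2.2.
Definition rtgt : 'S_n := pcomp rsrc (tperm rleft rright).

(* The pair p stands for the unit square with bottom left corner p. *)
Definition rchain : {ffun 'I_n * 'I_n -> nat} :=
  [ffun p => nat_of_bool (in_arc rleft rright p.1
                          && in_arc (rsrc rleft) (rsrc rright) p.2)].

Definition horizontally_torn : bool := (rright < rleft)%N.

End Rectangles.

Definition juxtaposable n (r1 r2 : rect n) : Prop := rtgt r1 = rsrc r2.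

(* A domain is recorded as its source, its target and its 2-chain. *)
Definition juxt n (r1 r2 : rect n) :
    'S_n * 'S_n * {ffun 'I_n * 'I_n -> nat} :=
  (rsrc r1, rtgt r2, [ffun p => (rchain r1 p + rchain r2 p)%N]).

Definition vertical_annulus n (D : 'S_n * 'S_n * {ffun 'I_n * 'I_n -> nat}) :
    Prop :=
  exists a b : 'I_n, a != b /\ D.2 = [ffun p => nat_of_bool (in_arc a b p.1)].

Definition horizontal_annulus n (D : 'S_n * 'S_n * {ffun 'I_n * 'I_n -> nat}) :
    Prop :=
  exists a b : 'I_n, a != b /\ D.2 = [ffun p => nat_of_bool (in_arc a b p.2)].

Definition sign_assignment n (S : rect n -> int) : Prop :=
  [/\ forall r, is_sign (S r),
      forall r1 r2 r1' r2', juxtaposable r1 r2 -> juxtaposable r1' r2' ->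
        uniq [:: r1; r2; r1'; r2'] -> juxt r1 r2 = juxt r1' r2' ->
        S r1 * S r2 = - (S r1' * S r2'),
      forall r1 r2, juxtaposable r1 r2 -> vertical_annulus (juxt r1 r2) ->
        S r1 * S r2 = -1
    & forall r1 r2, juxtaposable r1 r2 -> horizontal_annulus (juxt r1 r2) ->
        S r1 * S r2 = 1].

Definition torn_sign n (r : rect n) : int :=
  if horizontally_torn r then -1 else 1.

(* The generator x is the first argument of the cocycle because the
   differential multiplies on the right, by the lift of x^-1.y = tau_{i,j}.
   The swapped cocycle (x^-1.y) x violates all three axioms when n = 3. *)
Definition grid_sign n (r : rect n) : int :=
  torn_sign r * cocycle (rsrc r) (pcomp (rsrc r)^-1%g (rtgt r)).

(* Main.v *)
Require Import Defs.
From HB Require Import structures.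
From mathcomp Require Import all_boot all_order all_algebra all_fingroup.
From mathcomp Require Import boolp classical_sets zify.

Set Implicit Arguments.
Unset Strict Implicit.
Unset Printing Implicit Defensive.

(* The composition of permutations must take precedence over the composition
   of partial functions, which has the same name. *)
Import Defs GRing.Theory.

(** The lifted transposition t~_{i,j} behaves like the vector e_i - e_j of a
    Clifford algebra whose generators e_0, e_1, ... anticommute, with z acting
    as -1.  This picture explains every sign.  The vector is odd in (i, j),
    whence t~_{j,i} = z t~_{i,j}; conjugating by a vector is minus the
    reflection that it defines, whence the relation [spin_tau_conj]
        t~_{k,l} t~_{i,j} = z t~_{s(i),s(j)} t~_{k,l}   with s = tau_{k,l}.
    Two disjoint pairs thus anticommute ([spin_tau_disjoint]), and the three
    ways of writing a 3-cycle as a product along the oriented triangle a, b, c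
    agree ([spin_tau_rot]).

    The conjugation relation also shows that the products s(x), up to z, are
    stable under right multiplication by lifted transpositions ([fact_close]).
    So s(x) s(y) and s(x.y) differ by a power of z: the cocycle takes a value,
    and as s(tau_{i,j}) = t~_{i,j} when i < j, while a torn rectangle replaces
    t~_{j,i} by t~_{i,j} = z t~_{j,i}, the sign S(r) of a rectangle from x to y
    over the columns (i, j) satisfies s(x) t~_{i,j} = S(r) s(y) ([grid_signP]).
    A sign can be read off such an equation because z is not 1, which is where
    an actual Clifford algebra is needed ([spin_z_neq1]).

    For two consecutive rectangles, S(r1) S(r2) is determined by the product of
    the two lifted transpositions.  An annulus forces the two pairs of columns
    to be equal (vertical) or opposite (horizontal), and the products are
    t~_{i,j}^2 = z and t~_{i,j} t~_{j,i} = 1.  For two decompositions of the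
    same domain, the equality of the targets leaves few possibilities for the
    pairs of columns up to orientation: equal pairs, two disjoint pairs, or two
    sides of a triangle.  The equality of the 2-chains then decides the
    orientations: it excludes equal pairs, exchanges disjoint pairs without
    reversing them, and reverses an odd number of the four sides of the triangle
    that occur.  In each case the two products differ by z ([square_tau]). *)

(** * The central element is not trivial *)

Section Clifford.
Local Open Scope ring_scope.

Definition mx2 (R : nzRingType) (a b c d : R) : 'M[R]_2 :=
  \matrix_(i, j) if i == 0 then if j == 0 then a else b
                 else if j == 0 then c else d.

Lemma mx2M (R : nzRingType) (a b c d a' b' c' d' : R) :
  mx2 a b c d * mx2 a' b' c' d' =
  mx2 (a * a' + b * c') (a * b' + b * d') (c * a' + d * c') (c * b' + d * d').
Proof.
apply/matrixP=> i j; rewrite !mxE big_ord_recl big_ord1 !mxE /=.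
by do 2 case: ifP => _.
Qed.

Lemma mx2N (R : nzRingType) (a b c d : R) :
  - mx2 a b c d = mx2 (- a) (- b) (- c) (- d).
Proof. by apply/matrixP=> i j; rewrite !mxE; do 2 case: ifP => _. Qed.

Lemma mx2_1 (R : nzRingType) : 1 = mx2 1 0 0 1 :> 'M[R]_2.
Proof.
apply/matrixP=> i j; rewrite !mxE.
by case: i => -[|[|i]] //= hi; case: j => -[|[|j]].
Qed.

(** Doubling: when e_0, ..., e_(N-1) are anticommuting elements of square 1 in
    R, so are the matrices diag(e_k, -e_k) and the exchange matrix in 'M[R]_2.
    In characteristic 3 the differences e_i - e_j, of square 2 = -1, need no
    normalisation by the square root of 2. *)
Lemma clifford_char3 (N : nat) : exists (R : nzRingType) (e : nat -> R),
  [/\ 3%:R = 0 :> R, forall k, (k < N)%N -> e k * e k = 1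
    & forall k l, (k < N)%N -> (l < N)%N -> k != l -> e k * e l = - (e l * e k)].
Proof.
elim: N => [|N [R [e [R3 sq_e anti_e]]]].
  by exists 'F_3, (fun=> 0); split=> //; exact/val_inj.
exists 'M[R]_2,
  (fun k => if k == N then mx2 0 1 1 0 else mx2 (e k) 0 0 (- e k)).
split=> [|k|k l].
- by apply/matrixP=> i j; rewrite -scaler_nat R3 scale0r !mxE.
- rewrite ltnS leq_eqVlt mx2_1; case: eqP => [_ _|_ /= kN]; rewrite mx2M.
    by rewrite !(mulr0, mul0r, mulr1, addr0, add0r).
  by rewrite mulrNN sq_e // !(mulr0, mul0r, addr0, add0r).
rewrite !ltnS => kN lN kl; case: (eqVneq k N) => [kE|kN']; [|case: (eqVneq l N)].
- have lN' : l != N by rewrite eq_sym -kE.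
  rewrite (negPf lN') !mx2M mx2N !(mulr0, mul0r, mulr1, mul1r, addr0, add0r).
  by rewrite oppr0 opprK.
- by rewrite !mx2M mx2N !(mulr0, mul0r, mulr1, mul1r, addr0, add0r) oppr0 opprK.
move=> lN'; rewrite !mx2M mx2N !(mulr0, mul0r, addr0, add0r) oppr0 !mulrNN.
by rewrite (anti_e k l) // ltn_neqAle ?kN' ?lN'.
Qed.

Definition anticomm (R : nzRingType) (x y : R) := x * y + y * x.

Lemma anticommC (R : nzRingType) (x y : R) : anticomm x y = anticomm y x.
Proof. exact: addrC. Qed.

Lemma anticommB (R : nzRingType) (x y w : R) :
  anticomm (x - y) w = anticomm x w - anticomm y w.
Proof. by rewrite /anticomm mulrBl mulrBr opprD addrACA. Qed.

(** The vectors u_i = e_i - e_(i+1) satisfy the relations of the spin extension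
    with z replaced by -1.  The braid relation is the identity
    u v u = u + v = v u v, valid because u^2 = v^2 = -1 and u v + v u = 1. *)
Lemma spin_vectors (n : nat) : exists (R : nzRingType) (u : nat -> R),
  [/\ 1 != -1 :> R, forall i, (i.+1 < n)%N -> u i * u i = -1,
      forall i j, (i.+1 < j)%N -> (j.+1 < n)%N -> u i * u j = - (u j * u i)
    & forall i, (i.+2 < n)%N -> u i * u i.+1 * u i = u i.+1 * u i * u i.+1].
Proof.
have [R [e [R3 sq_e anti_e]]] := clifford_char3 n.
have N2 : 2%:R = -1 :> R by apply/eqP; rewrite -subr_eq0 opprK natr1 R3.
have anti_ee k : (k < n)%N -> anticomm (e k) (e k) = -1.
  by move=> kn; rewrite /anticomm sq_e // -N2.
have anti_ne k l : (k < n)%N -> (l < n)%N -> k != l -> anticomm (e k) (e l) = 0.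
  by move=> kn ln kl; rewrite /anticomm anti_e // addNr.
have sq i : (i.+1 < n)%N -> (e i - e i.+1) * (e i - e i.+1) = -1.
  move=> hi; rewrite mulrBl !mulrBr !sq_e //; last by lia.
  rewrite (anti_e i i.+1) //; try lia.
  by rewrite opprK opprB [LHS]addrC addrA (addrAC 1) subrK -N2.
exists R, (fun i => e i - e i.+1); split=> [||i j ij jn|i hi]; last 2 first.
- apply/eqP; rewrite -addr_eq0 -/(anticomm _ _) anticommB.
  rewrite !(anticommC _ (e j - _)) !anticommB !anti_ne ?subr0 //; lia.
- set u := e i - e i.+1; set v := e i.+1 - e i.+2.
  have uv : u * v = 1 - v * u.
    apply/eqP; rewrite -subr_eq0 opprB addrA -/(anticomm u v) subr_eq0.
    apply/eqP; rewrite /u /v anticommB !(anticommC _ (e i.+1 - _)) !anticommB.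
    by rewrite anti_ee ?anti_ne ?subr0 ?sub0r ?opprK //; lia.
  have uu : u * u = -1 by apply: sq; lia.
  have vv : v * v = -1 by exact: sq.
  have vu : v * u = 1 - u * v by rewrite uv opprB addrCA subrr addr0.
  have -> : u * v * u = u + v by rewrite uv mulrBl mul1r -mulrA uu mulrN1 opprK.
  by rewrite vu mulrBl mul1r -mulrA vv mulrN1 opprK addrC.
- rewrite -N2; apply/eqP => e12.
  by have /eqP := oner_neq0 R; apply; rewrite -R3 -(natr1 2) -e12.
- exact: sq.
Qed.

End Clifford.

Section CliffordWord.
Local Open Scope ring_scope.

Variables (n : nat) (R : nzRingType) (u : nat -> R).

(** The inverse of a generator t~_i goes to - u_i, since u_i^2 = -1. *)
Definition letter_val (l : option 'I_n.-1 * bool) : R :=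
  if l.1 is Some i then (if l.2 then - u i else u i) else -1.

Definition word_val (w : gword (option 'I_n.-1)) : R := \prod_(l <- w) letter_val l.

Hypothesis sq_u : forall i, (i.+1 < n)%N -> u i * u i = -1.
Hypothesis far_u :
  forall i j, (i.+1 < j)%N -> (j.+1 < n)%N -> u i * u j = - (u j * u i).
Hypothesis braid_u :
  forall i, (i.+2 < n)%N -> u i * u i.+1 * u i = u i.+1 * u i * u i.+1.

Lemma word_val_eqv w w' : gword_eqv (@spin_rel n) w w' -> word_val w = word_val w'.
Proof.
elim=> {w w'} [w w' ww'|a b|//|//|w1 w2 w3 _ -> _ -> //|
  w1 w1' w2 w2' _ IH1 _ IH2].
- rewrite /word_val; case: ww' => [|i|i|i j far|i j ji];
    rewrite /= !(big_cons, big_nil) /letter_val /= !mulr1 ?mulN1r ?mulrN1 ?opprK //.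
  + by apply: sq_u; have := ltn_ord i; lia.
  + have := ltn_ord i; have := ltn_ord j => jn hin.
    case/orP: far => h; first by apply: far_u => //; lia.
    by rewrite [X in - X]far_u ?opprK //; lia.
  + by rewrite !mulrA ji braid_u //; have := ltn_ord j; lia.
- rewrite /word_val !(big_cons, big_nil) mulr1 /letter_val /=.
  case: a => [i|] /=; last by rewrite mulrNN mulr1.
  by case: b; rewrite /= ?mulNr ?mulrN sq_u ?opprK //; have := ltn_ord i; lia.
- by rewrite /word_val !big_cat -/(word_val _) /= -!/(word_val _) IH1 IH2.
Qed.

End CliffordWord.

Local Open Scope group_scope.

Lemma spin_z_neq1 n : spin_z n != 1.
Proof.
have [R [u [N1 sq_u far_u braid_u]]] := spin_vectors n.
apply: contraNneq N1 => /presented_piP /(word_val_eqv sq_u far_u braid_u).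
by rewrite /word_val big_nil big_seq1 => /esym/eqP.
Qed.

(** * Relations between the lifted transpositions *)

Section Relations.
Variable n : nat.
Local Notation z := (spin_z n).
Local Notation t := (spin_t n).
Local Notation T := (spin_tau_lt n).

Lemma spin_tE (k : 'I_n.-1) : t k = presented_gen (@spin_rel n) (Some k).
Proof. by rewrite /spin_t valK. Qed.

Lemma spin_tP k : k.+1 < n -> exists i : 'I_n.-1, i = k :> nat.
Proof. by move=> kn; have kn' : k < n.-1 by [lia]; exists (Ordinal kn'). Qed.

Lemma spin_z2 : z * z = 1.
Proof. by have := presented_rel (@spin_zz n); rewrite !big_cons !big_nil mulg1. Qed.

Lemma spin_zC (g : spin n) : z * g = g * z.
Proof.
rewrite -(presented_reprK g); elim: (generic_quotient.repr g) => [|[a b] w IH].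
  by rewrite -[presented_pi _ _]/(1 : spin n) mulg1 mul1g.
rewrite -cat1s -presented_mulE -[presented_mul _ _]/((_ : spin n) * _) mulgA.
suff -> : z * presented_pi (@spin_rel n) [:: (a, b)]
          = presented_pi (@spin_rel n) [:: (a, b)] * z by rewrite -!mulgA IH.
have zgen : commute z (presented_gen (@spin_rel n) a).
  case: a => [i|//]; have := presented_rel (@spin_zt n i).
  by rewrite !big_cons !big_nil !mulg1.
case: b => //.
suff -> : presented_pi (@spin_rel n) [:: (a, true)]
          = (presented_gen (@spin_rel n) a)^-1 by exact: commuteV.
apply: (mulgI (presented_gen (@spin_rel n) a)); rewrite mulgV.
rewrite -[_ * _]/(presented_mul _ _) presented_mulE.
by apply/presented_piP; exact: (gword_cancel _ a false).
Qed.

Lemma spin_t2 k : k.+1 < n -> t k * t k = z.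
Proof.
move=> /spin_tP[i <-]; rewrite spin_tE.
by have := presented_rel (spin_tt i); rewrite !big_cons !big_nil !mulg1.
Qed.

Lemma spin_t_far i j : i.+1 < n -> j.+1 < n -> (i.+1 < j) || (j.+1 < i) ->
  t i * t j = z * (t j * t i).
Proof.
move=> /spin_tP[i' <-] /spin_tP[j' <-] ij; rewrite !spin_tE.
by have := presented_rel (spin_far ij); rewrite !big_cons !big_nil !mulg1.
Qed.

Lemma spin_t_braid i : i.+2 < n ->
  t i * t i.+1 * t i = t i.+1 * t i * t i.+1.
Proof.
move=> hi; have [|i' i'E] := @spin_tP i; first by lia.
have [j' j'E] := spin_tP hi; rewrite -j'E -i'E !spin_tE.
have := @presented_rel _ (@spin_rel n) _ _ (@spin_braid n i' j' _).
rewrite !big_cons !big_nil !mulg1 !mulgA; apply.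
by rewrite j'E i'E.
Qed.

Lemma tau_ltS i : T i i.+1 = t i.
Proof. by rewrite /spin_tau_lt subSnn big_seq1. Qed.

Lemma tau_lt_recl i j : i.+1 < j -> T i j = t i * T i.+1 j * t i.
Proof.
move=> ij; rewrite /spin_tau_lt.
have -> : j - i = (j - i.+2).+2 by lia.
have -> : j - i.+1 = (j - i.+2).+1 by lia.
set d := j - i.+2; rewrite [iota i d.+2]/= -[_.+2.-1]/d.+1 -[_.+1.-1]/d.
by rewrite [iota i d.+1]/= rev_cons -cats1 catA big_cat big_seq1 cat_cons big_cons.
Qed.

Lemma spin_zCA (g h : spin n) : g * (z * h) = z * (g * h).
Proof. by rewrite mulgA -spin_zC -mulgA. Qed.

Lemma spin_zK (g : spin n) : z * (z * g) = g.
Proof. by rewrite mulgA spin_z2 mul1g. Qed.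

Lemma tau_lt_far i j k : i < j < n -> k.+1 < n -> (k.+1 < i) || (j < k) ->
  t k * T i j = z * (T i j * t k).
Proof.
case/andP=> ij; have -> : j = (i + (j - i.+1)).+1 by lia.
move: (j - i.+1) {ij} => d; elim: d i => [|d IH] i dn kn far.
  by rewrite addn0 tau_ltS spin_t_far //; lia.
have tki : t k * t i = z * (t i * t k) by apply: spin_t_far; lia.
rewrite tau_lt_recl; last by lia.
rewrite !mulgA tki -!mulgA (mulgA (t k)) addnS -addSn IH; try lia.
by rewrite -!mulgA tki !spin_zCA spin_zK.
Qed.

(** The definition of t~_{i,j} peels off the outer letters t~_i; the braid and
    far relations turn the word inside out, so that t~_(j-1) may be peeled off
    instead.  Both forms are needed to conjugate by a generator that moves i
    or j. *)
Lemma tau_lt_recr i j : i < j -> j.+1 < n -> T i j.+1 = t j * T i j * t j.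
Proof.
move=> ij; have -> : j = (i + (j - i.+1)).+1 by lia.
move: (j - i.+1) {ij} => d; elim: d i => [|d IH] i dn.
  rewrite addn0 tau_lt_recl // !tau_ltS; apply: spin_t_braid; lia.
rewrite tau_lt_recl; last by lia.
rewrite [in RHS]tau_lt_recl; last by lia.
rewrite addnS -addSn IH; last by lia.
set k := (i.+1 + d).+1.
have tki : t k * t i = z * (t i * t k) by apply: spin_t_far; lia.
have tik : t i * t k = z * (t k * t i) by apply: spin_t_far; lia.
by rewrite !mulgA tik tki -!mulgA tki !spin_zCA spin_zK.
Qed.

(** The word of t~_{i,j} contains t~_k twice, but a braid move carries t~_k
    across each half of it as t~_(k-1), which is far from the middle. *)
Lemma tau_lt_mid i j k : i < k -> k.+1 < j < n -> t k * T i j = z * (T i j * t k).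
Proof.
move=> ik; have -> : k = (i + (k - i.+1)).+1 by lia.
move: (k - i.+1) {ik} => d; elim: d i => [|d IH] i /andP[kj jn].
  rewrite addn0 tau_lt_recl; last by lia.
  rewrite tau_lt_recl; last by lia.
  have br g : t i.+1 * (t i * (t i.+1 * g)) = t i * (t i.+1 * (t i * g)).
    by rewrite !mulgA spin_t_braid //; lia.
  have br1 : t i.+1 * (t i * t i.+1) = t i * (t i.+1 * t i).
    by rewrite !mulgA spin_t_braid //; lia.
  rewrite -!mulgA br [in LHS](mulgA (t i) (T _ _)) tau_lt_far //; try lia.
  by rewrite -!mulgA br1 !spin_zCA.
have IHi : t (i + d.+1).+1 * T i.+1 j = z * (T i.+1 j * t (i + d.+1).+1).
  by rewrite addnS -addSn; apply: IH; lia.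
set m := (i + d.+1).+1.
have tki : t m * t i = z * (t i * t m) by apply: spin_t_far; lia.
rewrite tau_lt_recl; last by lia.
by rewrite !mulgA tki -!mulgA (mulgA (t m)) IHi -!mulgA tki !spin_zCA spin_zK.
Qed.

Definition swapn (a b m : nat) : nat :=
  if m == a then b else if m == b then a else m.

Lemma swapnP a b m :
  m = a /\ swapn a b m = b \/ m <> a /\ m = b /\ swapn a b m = a \/
  m <> a /\ m <> b /\ swapn a b m = m.
Proof. by rewrite /swapn; case: eqP => ma; [|case: eqP => mb]; auto. Qed.

Ltac swapn_lia :=
  repeat match goal with
  | |- context [swapn ?a ?b ?m] =>
      generalize (swapnP a b m); generalize (swapn a b m)
  end; intros; lia.

(** The lifted transpositions on natural numbers, where k.+1 can be formed
    without a bound proof and inductions on the distance are possible. *)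
Definition tau_nat (i j : nat) : spin n :=
  if i < j then T i j else if j < i then z * T j i else 1.

Lemma tau_natC i j : i != j -> tau_nat j i = z * tau_nat i j.
Proof. by rewrite /tau_nat; case: ltngtP => // _ _; rewrite spin_zK. Qed.

Lemma tau_nat_conj_lt k i j : k.+1 < n -> i < j < n ->
  t k * tau_nat i j = z * (tau_nat (swapn k k.+1 i) (swapn k k.+1 j) * t k).
Proof.
move=> kn /andP[ij jn]; rewrite {1}/tau_nat ij /swapn.
have tauE a b : a < b -> tau_nat a b = T a b by rewrite /tau_nat => ->.
have tauE' a b : b < a -> tau_nat a b = z * T b a.
  by rewrite /tau_nat; case: ltngtP.
case: (ltngtP i k) => [ik|ki|ik].
- have -> : i == k.+1 = false by lia.
  case: (ltngtP j k) => [jk|kj|jk].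
  + have -> : j == k.+1 = false by lia.
    by rewrite tauE // tau_lt_far ?jk ?orbT ?ij.
  + case: (eqVneq j k.+1) => [jk1|jk1]; rewrite tauE //; last first.
      by apply: tau_lt_mid; lia.
    by rewrite jk1 tau_lt_recr // !mulgA spin_t2.
  + rewrite jk tauE; last by lia.
    rewrite tau_lt_recr -?jk -?mulgA //; last by lia.
    by rewrite spin_t2 ?jk // -spin_zC spin_zCA spin_zK.
- have -> : j == k = false by lia.
  have -> : j == k.+1 = false by lia.
  case: (eqVneq i k.+1) => [ik1|ik1].
  + rewrite tauE; last by lia.
    rewrite (@tau_lt_recl k); last by lia.
    by rewrite ik1 -!mulgA spin_t2 // -spin_zC spin_zCA spin_zK.
  + by rewrite tauE // tau_lt_far ?ij //; lia.
- rewrite -ik; have -> : j == i = false by lia.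
  case: (eqVneq j i.+1) => [ji1|ij1].
  + by rewrite ji1 tauE' // tau_ltS -!mulgA spin_zK.
  + rewrite tauE; last by lia.
    rewrite tau_lt_recl; last by lia.
    by rewrite !mulgA spin_t2 ?ik // -!mulgA.
Qed.

Lemma tau_nat_conj_adj k i j : k.+1 < n -> i < n -> j < n -> i != j ->
  t k * tau_nat i j = z * (tau_nat (swapn k k.+1 i) (swapn k k.+1 j) * t k).
Proof.
move=> kn hin jn ij; case: (ltngtP i j) ij => // ij _.
  by apply: tau_nat_conj_lt; rewrite // ij.
rewrite tau_natC; last by lia.
rewrite (@tau_natC (swapn k k.+1 j)); last swapn_lia.
by rewrite spin_zCA tau_nat_conj_lt ?ij // -!mulgA.
Qed.

(** Each of the 2(l - k) - 1 letters of t~_{k,l} contributes a factor z and acts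
    on the indices by its transposition; the number of letters is odd. *)
Lemma tau_nat_conj k l i j : k < l < n -> i < n -> j < n -> i != j ->
  T k l * tau_nat i j = z * (tau_nat (swapn k l i) (swapn k l j) * T k l).
Proof.
case/andP=> kl; have -> : l = (k + (l - k.+1)).+1 by lia.
move: (l - k.+1) {kl} => d; elim: d k i j => [|d IH] k i j dn hin jn ij.
  by rewrite addn0 tau_ltS tau_nat_conj_adj //; lia.
rewrite tau_lt_recl; last by lia.
have swE m : swapn k (k + d.+1).+1 m
   = swapn k k.+1 (swapn k.+1 (k.+1 + d).+1 (swapn k k.+1 m)).
  swapn_lia.
rewrite !swE addnS -addSn -!mulgA; set l' := (k.+1 + d).+1.
set i1 := swapn k k.+1 i; set j1 := swapn k k.+1 j.
set i2 := swapn k.+1 l' i1; set j2 := swapn k.+1 l' j1.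
have -> : t k * tau_nat i j = z * (tau_nat i1 j1 * t k).
  by apply: tau_nat_conj_adj => //; lia.
have step2 g : T k.+1 l' * (tau_nat i1 j1 * g)
  = z * (tau_nat i2 j2 * (T k.+1 l' * g)).
  by rewrite mulgA IH -?mulgA // /l' ?/i1 ?/j1; swapn_lia.
have step3 g : t k * (tau_nat i2 j2 * g)
  = z * (tau_nat (swapn k k.+1 i2) (swapn k k.+1 j2) * (t k * g)).
  by rewrite mulgA tau_nat_conj_adj -?mulgA // /i2 /j2 /i1 /j1 /l'; swapn_lia.
by rewrite !spin_zCA step2 !spin_zCA step3 spin_zK.
Qed.

Lemma tau_lt_sq k l : k < l < n -> T k l * T k l = z.
Proof.
case/andP=> kl; have -> : l = (k + (l - k.+1)).+1 by lia.
move: (l - k.+1) {kl} => d; elim: d k => [|d IH] k dn.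
  by rewrite addn0 tau_ltS spin_t2 //; lia.
have tk2 : t k * t k = z by apply: spin_t2; lia.
rewrite tau_lt_recl; last by lia.
rewrite addnS -addSn -!mulgA (mulgA (t k) (t k)) tk2 !spin_zCA.
by rewrite (mulgA (T _ _)) IH ?spin_zCA ?tk2 ?spin_zK //; lia.
Qed.

End Relations.

Section LiftedTranspositions.
Variable n : nat.
Local Notation z := (spin_z n).
Implicit Types a b c d i j k l : 'I_n.

Lemma spin_tauE i j : spin_tau i j = tau_nat n i j.
Proof. by []. Qed.

Lemma spin_tau1 i : spin_tau i i = 1.
Proof. by rewrite /spin_tau ltnn. Qed.

Lemma spin_tauC i j : i != j -> spin_tau j i = z * spin_tau i j.
Proof. by move=> ij; rewrite !spin_tauE; apply: tau_natC. Qed.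

Lemma spin_tau_sq i j : i != j -> spin_tau i j * spin_tau i j = z.
Proof.
rewrite -val_eqE /spin_tau /= => ij.
case: (ltngtP i j) ij => // [ij|ji] _; first by rewrite tau_lt_sq // ij ltn_ord.
by rewrite -!mulgA spin_zCA spin_zK tau_lt_sq // ji ltn_ord.
Qed.

Lemma val_tperm k l i : val (tperm k l i) = swapn k l i.
Proof.
rewrite /swapn !val_eqE permE /=.
by case: (i =P k) => // _; case: (i =P l).
Qed.

Lemma spin_tau_conj k l i j : k != l -> i != j ->
  spin_tau k l * spin_tau i j
  = z * (spin_tau (tperm k l i) (tperm k l j) * spin_tau k l).
Proof.
wlog kl : k l / (k < l)%N => [wl|_ ij].
  move=> kl ij; have [lt_kl|] := ltnP k l; first exact: wl.
  rewrite leq_eqVlt eq_sym val_eqE (negPf kl) => lt_lk.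
  have lk : l != k by rewrite eq_sym.
  by rewrite (spin_tauC lk) -mulgA (wl l k) // (tpermC l) !spin_zCA.
rewrite !spin_tauE /=.
have -> : tau_nat n k l = spin_tau_lt n k l by rewrite /tau_nat kl.
by rewrite !val_tperm tau_nat_conj // kl ltn_ord.
Qed.

Lemma spin_tau_disjoint a b c d : a != b -> c != d ->
    a != c -> a != d -> b != c -> b != d ->
  spin_tau a b * spin_tau c d = z * (spin_tau c d * spin_tau a b).
Proof. by move=> ab cd ac ad bc bd; rewrite spin_tau_conj // !tpermD. Qed.

(** By conjugation the left side is z t~_{a,c} t~_{a,b}; the factor z reverses
    the pair (a, c).  So the product is invariant under rotation of the
    triangle. *)
Lemma spin_tau_rot a b c : a != b -> b != c -> c != a ->
  spin_tau a b * spin_tau b c = spin_tau c a * spin_tau a b.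
Proof.
move=> ab bc ca; rewrite spin_tau_conj // tpermR tpermD 1?(eq_sym a) //.
by rewrite (spin_tauC ca) -mulgA spin_zK.
Qed.

End LiftedTranspositions.

(** * The section and its cocycle *)

Fact pcompA n : associative (@pcomp n).
Proof. by move=> x y w; rewrite /pcomp mulgA. Qed.

Fact pcomp1x n : left_id 1 (@pcomp n).
Proof. by move=> x; rewrite /pcomp mulg1. Qed.

Fact pcompx1 n : right_id 1 (@pcomp n).
Proof. by move=> x; rewrite /pcomp mul1g. Qed.

HB.instance Definition _ n :=
  Monoid.isLaw.Build 'S_n 1 (@pcomp n) (@pcompA n) (@pcomp1x n) (@pcompx1 n).

(** The products defining the section are cut after the factors of index less
    than m, so that they can be studied by induction on m. *)
Lemma big_ord_ltS (R : Type) (idx : R) (op : Monoid.law idx) n (F : 'I_n -> R)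
    (m : 'I_n) :
  \big[op/idx]_(k < n | k < m.+1) F k = op (\big[op/idx]_(k < n | k < m) F k) (F m).
Proof.
have mn := ltn_ord m; rewrite (big_ord_narrow mn) (big_ord_narrow (ltnW mn)).
rewrite big_ord_recr /=; congr (op _ (F _)); last exact: val_inj.
by apply: eq_bigr => k _; congr F; exact: val_inj.
Qed.

Section UpToCenter.
Variable n : nat.
Local Notation z := (spin_z n).
Implicit Types g h : spin n.

(** Having the same image in the symmetric group. *)
Definition eqmodz g h := exists b : bool, g = z ^+ b * h.

Lemma eqmodz_refl g : eqmodz g g.
Proof. by exists false; rewrite mul1g. Qed.

Lemma eqmodz_z g : eqmodz (z * g) g.
Proof. by exists true; rewrite expg1. Qed.

Lemma zexpD (b b' : bool) : z ^+ b * z ^+ b' = z ^+ (b (+) b').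
Proof. by case: b b' => [] [] /=; rewrite ?expg1 ?expg0 ?mulg1 ?mul1g ?spin_z2. Qed.

Lemma zexpC (b : bool) g : z ^+ b * g = g * z ^+ b.
Proof. by case: b; rewrite /= ?expg1 ?expg0 ?mulg1 ?mul1g // spin_zC. Qed.

Lemma eqmodz_trans g h k : eqmodz g h -> eqmodz h k -> eqmodz g k.
Proof. by move=> [b ->] [b' ->]; exists (b (+) b'); rewrite mulgA zexpD. Qed.

Lemma eqmodz_sym g h : eqmodz g h -> eqmodz h g.
Proof. by move=> [b ->]; exists b; rewrite mulgA zexpD addbb mul1g. Qed.

Lemma eqmodzM g g' h h' : eqmodz g g' -> eqmodz h h' -> eqmodz (g * h) (g' * h').
Proof.
move=> [b ->] [b' ->]; exists (b (+) b').
by rewrite -zexpD -!mulgA (mulgA g') -(zexpC b' g') -!mulgA.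
Qed.

End UpToCenter.

Section NormalForm.
Variable n : nat.
Local Notation z := (spin_z n).
Implicit Types (f : {ffun 'I_n -> 'I_n}) (x y : 'S_n) (g h : spin n).

Definition lower f := [forall k, f k <= k].

Definition fact_perm f m : 'S_n := \big[@pcomp n/1]_(k < n | k < m) tperm (f k) k.

Definition fact_spin f m : spin n := \prod_(k < n | k < m) spin_tau (f k) k.

Lemma fact_permS f (m : 'I_n) :
  fact_perm f m.+1 = pcomp (fact_perm f m) (tperm (f m) m).
Proof. exact: big_ord_ltS. Qed.

Lemma fact_spinS f (m : 'I_n) :
  fact_spin f m.+1 = fact_spin f m * spin_tau (f m) m.
Proof. exact: big_ord_ltS. Qed.

Lemma fact_perm0 f : fact_perm f 0 = 1.
Proof. by rewrite /fact_perm big_pred0. Qed.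

Lemma fact_spin0 f : fact_spin f 0 = 1.
Proof. by rewrite /fact_spin big_pred0. Qed.

Lemma is_factorizationE x f :
  is_factorization x f = lower f && (x == fact_perm f n).
Proof.
by congr (_ && (_ == _)); apply: eq_bigl => k; rewrite ltn_ord.
Qed.

Definition set_at f (m a : 'I_n) : {ffun 'I_n -> 'I_n} :=
  [ffun k => if k == m then a else f k].

Lemma set_at_lower f (m a : 'I_n) : lower f -> a <= m -> lower (set_at f m a).
Proof.
by move=> /forallP fl am; apply/forallP=> k; rewrite ffunE; case: eqP => [->|].
Qed.

Lemma set_at_permS f (m a : 'I_n) :
  fact_perm (set_at f m a) m.+1 = pcomp (fact_perm f m) (tperm a m).
Proof.
rewrite fact_permS ffunE eqxx; congr (pcomp _ _).
by apply: eq_bigr => k km; rewrite ffunE ifN // neq_ltn km.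
Qed.

Lemma set_at_spinS f (m a : 'I_n) :
  fact_spin (set_at f m a) m.+1 = fact_spin f m * spin_tau a m.
Proof.
rewrite fact_spinS ffunE eqxx; congr (_ * _).
by apply: eq_bigr => k km; rewrite ffunE ifN // neq_ltn km.
Qed.

Lemma pcomp_tpermC (s : 'S_n) (a b : 'I_n) :
  pcomp (tperm a b) s = pcomp s (tperm (s^-1 a) (s^-1 b)).
Proof. by rewrite /pcomp -tpermJ conjgE invgK -!mulgA mulVg mulg1. Qed.

Lemma spin_tau_commute (k l i j : 'I_n) :
  eqmodz (spin_tau i j * spin_tau k l)
      (spin_tau k l * spin_tau (tperm k l i) (tperm k l j)).
Proof.
have [->|kl] := eqVneq k l.
  by rewrite spin_tau1 tperm1 !perm1 mulg1 mul1g; exact: eqmodz_refl.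
have [->|ij] := eqVneq i j.
  by rewrite !spin_tau1 mulg1 mul1g; exact: eqmodz_refl.
rewrite [spin_tau k l * _]spin_tau_conj ?(inj_eq perm_inj) // !tpermK.
exact/eqmodz_sym/eqmodz_z.
Qed.

(** Coset enumeration.  The last factor t~_{a,m} is moved to the right past
    t~_{i,j}, where i < j.  If j < m, it stays of this form and t~_{i,j} joins
    the previous factors, which are handled by induction.  If j = m, the two factors merge
    when a = m or a = i; otherwise, up to z,
    t~_{a,m} t~_{i,m} = t~_{a,i} t~_{a,m}, and t~_{a,i} joins the previous
    factors. *)
Lemma fact_close m f (i j : 'I_n) : m <= n -> lower f -> i < m -> j < m ->
  exists f', [/\ lower f', fact_perm f' m = pcomp (fact_perm f m) (tperm i j)
    & eqmodz (fact_spin f m * spin_tau i j) (fact_spin f' m)].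
Proof.
elim: m f i j => // m IH f i j mn fl; rewrite !ltnS => im jm.
pose M := Ordinal mn; pose a := f M.
have am : a <= M by have /forallP := fl; exact.
have [->|neq_ij] := eqVneq i j.
  exists f; rewrite tperm1 pcompx1 spin_tau1 mulg1; split=> //.
  exact: eqmodz_refl.
(* Exchanging i and j changes the lifted transposition by z only. *)
wlog ij : i j im jm neq_ij / i < j.
  move=> wl; case: (ltngtP i j) => [|ji|/val_inj/eqP]; first exact: wl.
    have neq_ji : j != i by rewrite eq_sym.
    have [f' [f'l f'p f's]] := wl j i jm im neq_ji ji; exists f'; split=> //.
      by rewrite tpermC.
    apply: eqmodz_trans f's; apply: eqmodzM; first exact: eqmodz_refl.
    by rewrite (spin_tauC neq_ij); exact/eqmodz_sym/eqmodz_z.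
  by rewrite (negPf neq_ij).
rewrite [fact_perm f _](fact_permS f M) [fact_spin f _](fact_spinS f M) -/a.
have [jM|jM] := eqVneq j M; last first.
  have jlt : j < m.
    have : j <> m :> nat by [move=> jE; case/eqP: jM; exact: val_inj].
    by lia.
  have ilt : i < m by lia.
  have [f' [f'l f'p f's]] := IH f i j (ltnW mn) fl ilt jlt.
  have iM : i != M by rewrite -val_eqE /= neq_ltn ilt.
  have jM' : j != M by [].
  pose a' := tperm i j a.
  exists (set_at f' M a'); rewrite [fact_perm _ m.+1](set_at_permS _ M).
  rewrite [fact_spin _ m.+1](set_at_spinS _ M); split.
  - by apply: set_at_lower => //; rewrite /a'; case: tpermP.
  - by rewrite f'p -!pcompA [in RHS]pcomp_tpermC tpermV (tpermD iM jM').
  - rewrite -!mulgA.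
    apply: eqmodz_trans (eqmodzM (eqmodz_refl _) (spin_tau_commute _ _ _ _)) _.
    by rewrite mulgA (tpermD iM jM'); apply: eqmodzM; [|exact: eqmodz_refl].
rewrite jM; have [aM|aM] := eqVneq a M; last have [ai|ai] := eqVneq a i.
- exists (set_at f M i); rewrite [fact_perm _ m.+1](set_at_permS _ M).
  rewrite [fact_spin _ m.+1](set_at_spinS _ M) aM spin_tau1 tperm1 pcompx1 mulg1.
  by split; [exact: set_at_lower | | exact: eqmodz_refl].
- exists (set_at f M M); rewrite [fact_perm _ m.+1](set_at_permS _ M).
  rewrite [fact_spin _ m.+1](set_at_spinS _ M) -ai tperm1 spin_tau1 pcompx1 mulg1.
  split; [exact: set_at_lower | by rewrite -pcompA /pcomp tperm2 mul1g |].
  rewrite -mulgA spin_tau_sq // -spin_zC; exact: eqmodz_z.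
- have alt : a < m.
    have : a <> M :> nat by [move=> E; case/eqP: aM; exact: val_inj].
    by move: am => /=; lia.
  have ilt : i < m.
    by have := congr1 val jM; move: ij => /=; lia.
  have iM : i != M by rewrite -val_eqE /= neq_ltn ilt.
  have Mi : M != i by rewrite eq_sym.
  have [f' [f'l f'p f's]] := IH f a i (ltnW mn) fl alt ilt.
  exists (set_at f' M a); rewrite [fact_perm _ m.+1](set_at_permS _ M).
  rewrite [fact_spin _ m.+1](set_at_spinS _ M); split.
  + exact: set_at_lower.
  + by rewrite f'p -!pcompA pcomp_tpermC tpermV tpermL (tpermD ai Mi) (tpermC M).
  rewrite -mulgA; apply: eqmodz_trans (eqmodzM f's (eqmodz_refl _)).
  rewrite -mulgA; apply: eqmodzM; first exact: eqmodz_refl.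
  apply: eqmodz_sym; apply: eqmodz_trans (spin_tau_commute _ _ _ _) _.
  rewrite tpermL (tpermD ai Mi); apply: eqmodzM; first exact: eqmodz_refl.
  by rewrite (spin_tauC iM); exact: eqmodz_z.
Qed.

Lemma fact_perm_id f m (i : 'I_n) : lower f -> m <= i -> fact_perm f m i = i.
Proof.
move=> /forallP fl mi; rewrite /fact_perm.
apply: (big_ind (fun s : 'S_n => s i = i)) => [|s s' si s'i|k km].
- by rewrite perm1.
- by rewrite pcompE s'i.
- have fk := fl k; rewrite tpermD //; apply/eqP => E; subst i; lia.
Qed.

(** The last index f m is determined by the permutation, as the preimage of
    m. *)
Lemma fact_spin_uniq f f' m : m <= n -> lower f -> lower f' ->
  fact_perm f m = fact_perm f' m -> fact_spin f m = fact_spin f' m.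
Proof.
move=> + fl fl'; elim: m => [|m IH] mn; first by rewrite !fact_spin0.
pose M := Ordinal mn; rewrite !(fact_permS _ M) !(fact_spinS _ M) => E.
have preM (h : {ffun 'I_n -> 'I_n}) :
    lower h -> pcomp (fact_perm h M) (tperm (h M) M) (h M) = M.
  by move=> hl; rewrite pcompE tpermL fact_perm_id.
have fM : f M = f' M.
  apply: (@perm_inj _ (pcomp (fact_perm f M) (tperm (f M) M))).
  by rewrite preM // E preM.
rewrite fM in E *; rewrite IH //; first exact: ltnW.
exact: mulgI E.
Qed.

Lemma factorization_exists x : exists2 f, lower f & x = fact_perm f n.
Proof.
have [ts -> _] := prod_tpermP x; elim: ts => [|[i j] ts [f fl tsE]].
  exists [ffun k => k]; first by apply/forallP=> k; rewrite ffunE.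
  by rewrite big_nil /fact_perm big1 // => k _; rewrite ffunE tperm1.
have [f' [f'l f'p _]] := fact_close (leqnn n) fl (ltn_ord i) (ltn_ord j).
by exists f'; rewrite // f'p -tsE big_cons.
Qed.

Lemma sec_fact x f : lower f -> x = fact_perm f n -> sec x = fact_spin f n.
Proof.
move=> fl xE; rewrite /sec; case: pickP => [f'|/(_ f)]; rewrite is_factorizationE.
  case/andP=> fl' /eqP xE'; transitivity (fact_spin f' n).
    by apply: eq_bigl => k; rewrite ltn_ord.
  by apply: fact_spin_uniq; rewrite -?xE.
by rewrite fl xE eqxx.
Qed.

Lemma sec_tau x (i j : 'I_n) :
  eqmodz (sec x * spin_tau i j) (sec (pcomp x (tperm i j))).
Proof.
have [f fl xE] := factorization_exists x.
have [f' [f'l f'p f's]] := fact_close (leqnn n) fl (ltn_ord i) (ltn_ord j).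
by rewrite (sec_fact fl xE) (@sec_fact _ f') // f'p -xE.
Qed.

(** This is the existence of the cocycle.  The factors of s(y) are multiplied
    to s(x) one at a time; each step changes the section by a power of z. *)
Lemma sec_mul x y : eqmodz (sec x * sec y) (sec (pcomp x y)).
Proof.
have [f fl yE] := factorization_exists y.
suff mulm m : m <= n ->
    eqmodz (sec x * fact_spin f m) (sec (pcomp x (fact_perm f m))).
  by rewrite (sec_fact fl yE) yE; exact: mulm.
elim: m => [|m IH] mn.
  by rewrite fact_spin0 fact_perm0 mulg1 pcompx1; exact: eqmodz_refl.
pose M := Ordinal mn; rewrite (fact_permS _ M) (fact_spinS _ M) mulgA pcompA.
apply: eqmodz_trans (sec_tau _ _ _); apply: eqmodzM (IH (ltnW mn)) _.
exact: eqmodz_refl.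
Qed.

Lemma big_ord_only (R : Type) (idx : R) (op : Monoid.law idx) (F : 'I_n -> R) j :
  (forall k, k != j -> F k = idx) -> \big[op/idx]_(k < n | k < n) F k = F j.
Proof.
move=> F1; rewrite -(big_pred1_eq op j F) [RHS]big_mkcond.
apply: eq_big => k; first by rewrite ltn_ord.
by case: eqVneq => // kj _; apply: F1.
Qed.

Lemma sec_tperm (i j : 'I_n) : i <= j -> sec (tperm i j) = spin_tau i j.
Proof.
move=> ij; pose f := set_at [ffun k => k] j i.
have fj : f j = i by rewrite ffunE eqxx.
have fk k : k != j -> f k = k by move=> /negPf kj; rewrite ffunE kj ffunE.
have fl : lower f.
  by apply: set_at_lower => //; apply/forallP=> k; rewrite ffunE.
rewrite (@sec_fact _ f) //; last first.
  by rewrite /fact_perm (@big_ord_only _ _ _ _ j) ?fj // => k /fk ->; rewrite tperm1.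
by rewrite /fact_spin (@big_ord_only _ _ _ _ j) ?fj // => k /fk ->; rewrite spin_tau1.
Qed.

End NormalForm.

(** * The sign of a rectangle *)

Section GridSign.
Variable n : nat.
Local Notation z := (spin_z n).

Lemma sign_spinE e : sign_spin n e = z ^+ (e == -1)%R.
Proof. by rewrite /sign_spin; case: eqP => _ /=; rewrite ?expg1 ?expg0. Qed.

Lemma sign_spinM e e' : is_sign e -> is_sign e' ->
  sign_spin n (e * e')%R = sign_spin n e * sign_spin n e'.
Proof. by rewrite !sign_spinE => -[] -> [] ->; rewrite zexpD. Qed.

Lemma is_signM e e' : is_sign e -> is_sign e' -> is_sign (e * e')%R.
Proof. by move=> [] -> [] ->; [left | right | right | left]. Qed.

Lemma sign_spin_inj e e' : is_sign e -> is_sign e' ->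
  sign_spin n e = sign_spin n e' -> e = e'.
Proof.
move: (spin_z_neq1 n) => /eqP z1.
by rewrite !sign_spinE => -[] -> [] -> //=; rewrite expg1 expg0 => // /esym.
Qed.

Lemma cocycleP (x y : 'S_n) : is_sign (cocycle x y) /\
  sec x * sec y = sign_spin n (cocycle x y) * sec (pcomp x y).
Proof.
pose P : set int := fun e => is_sign e /\
  sec x * sec y = sign_spin n e * sec (pcomp x y).
apply: (@xgetPex _ _ P); have [b E] := sec_mul x y.
exists (if b then -1 else 1)%R; split; first by case: b {E}; [right | left].
by rewrite E sign_spinE; case: b {E}.
Qed.

Lemma torn_sign_sign (r : rect n) : is_sign (torn_sign r).
Proof. by rewrite /torn_sign; case: ifP; [right | left]. Qed.

Lemma rect_neq (r : rect n) : rleft r != rright r.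
Proof. by case: r => -[x [i j]] r_empty; have /andP[] := r_empty. Qed.

Lemma pcomp_src_tgt (r : rect n) :
  pcomp (rsrc r)^-1 (rtgt r) = tperm (rleft r) (rright r).
Proof. by rewrite /rtgt /pcomp -mulgA mulgV mulg1. Qed.

(** For a torn rectangle, the section of the transposition is t~_{j,i}, with
    the larger index second; the torn sign accounts for t~_{i,j} = z t~_{j,i}. *)
Lemma grid_signP (r : rect n) : is_sign (grid_sign r) /\
  sec (rsrc r) * spin_tau (rleft r) (rright r)
  = sign_spin n (grid_sign r) * sec (rtgt r).
Proof.
rewrite /grid_sign pcomp_src_tgt.
have [cs cE] := cocycleP (rsrc r) (tperm (rleft r) (rright r)).
have ts := torn_sign_sign r; split; first exact: is_signM.
rewrite sign_spinM // -mulgA -[rtgt r]/(pcomp _ _) -cE.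
rewrite /torn_sign /horizontally_torn sign_spinE; case: ltnP => [lt|le].
  rewrite expg1 tpermC sec_tperm 1?ltnW // spin_tauC 1?spin_zCA //.
  by rewrite eq_sym rect_neq.
by rewrite mul1g sec_tperm.
Qed.

End GridSign.

(** * Arcs of the circle *)

Section Arcs.
Variable n : nat.
Implicit Types (a b c d k : 'I_n) (e : 'I_n * 'I_n) (x : 'S_n).

Lemma in_arcE a b k :
  in_arc a b k = if a <= b then a <= k < b else (k < b) || (a <= k).
Proof.
have dE (u v : 'I_n) : cyc_dist u v = if u <= v then v - u else v + n - u.
  rewrite /cyc_dist; have := ltn_ord u; have := ltn_ord v => vn un.
  case: leqP => uv; last by rewrite modn_small; lia.
  have -> : v + (n - u) = (v - u) + n by lia.
  by rewrite modnDr modn_small; lia.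
rewrite /in_arc !dE; have := ltn_ord a; have := ltn_ord b; have := ltn_ord k.
by case: (leqP a b) => ?; case: (leqP a k) => ?; lia.
Qed.

Lemma in_arcl a b : a != b -> in_arc a b a.
Proof. by rewrite in_arcE -val_eqE /=; case: ifP; lia. Qed.

Lemma in_arcr a b : in_arc a b b = false.
Proof. by rewrite in_arcE; case: ifP; lia. Qed.

Lemma in_arcC a b k : a != b -> in_arc b a k = ~~ in_arc a b k.
Proof. by rewrite !in_arcE -val_eqE /=; do 2 case: ifP; lia. Qed.

Lemma in_arc_rot a b c : a != b -> b != c -> c != a ->
  in_arc b c a = in_arc a b c.
Proof. by rewrite !in_arcE -!val_eqE /=; do 2 case: ifP; lia. Qed.

(** The indicators are only compared at the four end points, which already
    determines the cyclic order. *)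
Lemma in_arc_inj a b c d : a != b -> c != d ->
  (forall k, in_arc a b k = in_arc c d k) -> a = c /\ b = d.
Proof.
move=> ab cd E; have := (E a, E b, E c, E d).
rewrite !in_arcE; move: ab cd; rewrite -!val_eqE /=.
by case: ifP; case: ifP => cdE abE ab cd [[[Ea Eb] Ec] Ed];
  split; apply: val_inj => /=; lia.
Qed.

Lemma in_arc_compl a b c d : a != b -> c != d ->
  (forall k, in_arc a b k = ~~ in_arc c d k) -> a = d /\ b = c.
Proof.
move=> ab cd E; apply: in_arc_inj => //; first by rewrite eq_sym.
by move=> k; rewrite (in_arcC _ cd) E.
Qed.

End Arcs.

(** * Two rectangles with the same juxtaposition *)

Section Squares.
Variable n : nat.
Local Notation z := (spin_z n).
Implicit Types (a b c d i j k l p q : 'I_n) (e : 'I_n * 'I_n) (x y : 'S_n).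
Implicit Types f g : bool.

(** An ordered pair is kept as an unordered one with a flag for its
    orientation: reversing it only multiplies [tau] by z and complements both
    arcs of the rectangle. *)
Definition orient f a b : 'I_n * 'I_n := if f then (b, a) else (a, b).

Definition swap e : 'S_n := tperm e.1 e.2.

Definition tau e : spin n := spin_tau e.1 e.2.

Definition chain x e p q : nat := in_arc e.1 e.2 p && in_arc (x e.1) (x e.2) q.

Definition chain2 x e1 e2 p q : nat :=
  chain x e1 p q + chain (pcomp x (swap e1)) e2 p q.

Lemma swap_orient f a b : swap (orient f a b) = tperm a b.
Proof. by case: f; rewrite /swap //= tpermC. Qed.

Lemma tau_orient f a b : a != b -> tau (orient f a b) = z ^+ f * spin_tau a b.
Proof.
by case: f => ab; rewrite /tau /= ?mul1g // expg1; apply: spin_tauC.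
Qed.

Lemma chain_orient x f a b p q : a != b ->
  chain x (orient f a b) p q
  = (f (+) in_arc a b p) && (f (+) in_arc (x a) (x b) q) :> nat.
Proof.
by case: f => ab //; rewrite /chain /= !(in_arcC _ ab, in_arcC _ (_ : x a != x b)) //
  (inj_eq perm_inj).
Qed.

Definition disjoint_pairs e1 e2 :=
  [&& e1.1 != e2.1, e1.1 != e2.2, e1.2 != e2.1 & e1.2 != e2.2].

Variant pair_spec e1 e2 : Prop :=
| PairSame f of e2 = orient f e1.1 e1.2
| PairDisjoint of disjoint_pairs e1 e2
| PairPath a b c f g of e1 = orient f a b & e2 = orient g b c
    & [&& a != b, b != c & c != a].

Lemma pairP e1 e2 : e1.1 != e1.2 -> e2.1 != e2.2 -> pair_spec e1 e2.
Proof.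
case: e1 e2 => [i j] [k l] /= ij kl.
have [ik|ik] := eqVneq i k; first subst k.
  have [jl|jl] := eqVneq j l; first by subst l; exact: (PairSame (f := false)).
  by apply: (@PairPath _ _ j i l true false); rewrite //= eq_sym ij kl eq_sym.
have [il|il] := eqVneq i l; first subst l.
  have [jk|jk] := eqVneq j k; first by subst k; exact: (PairSame (f := true)).
  by apply: (@PairPath _ _ j i k true true); rewrite //= eq_sym ij ik eq_sym.
have [jk|jk] := eqVneq j k; first subst k.
  by apply: (@PairPath _ _ i j l false false); rewrite //= ij kl eq_sym.
have [jl|jl] := eqVneq j l; first subst l.
  by apply: (@PairPath _ _ i j k false true); rewrite //= ij jk eq_sym.
by apply: PairDisjoint; rewrite /disjoint_pairs /= ik il jk jl.
Qed.

(** ** A pair of rectangles on one pair of columns *)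

(** The two rectangles fill a vertical annulus, or a horizontal one when the
    second pair of columns is reversed. *)
Lemma chain2_same x a b f p q : a != b ->
  chain2 x (a, b) (orient f a b) p q
  = (if f then in_arc (x a) (x b) q else in_arc a b p) :> nat.
Proof.
move=> ab; have xab : x a != x b by rewrite (inj_eq perm_inj).
rewrite /chain2 chain_orient // !pcompE tpermL tpermR (in_arcC _ xab) /chain /=.
by case: f (in_arc a b p) (in_arc (x a) (x b) q) => [] [] [].
Qed.

Lemma chain2_same_inj x a b c d f g : a != b -> c != d ->
  (forall p q, chain2 x (a, b) (orient f a b) p q
               = chain2 x (c, d) (orient g c d) p q) ->
  a = c /\ b = d.
Proof.
move=> ab cd E.
have xab : x a != x b by rewrite (inj_eq perm_inj).
have xcd : x c != x d by rewrite (inj_eq perm_inj).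
have {}E p q : (if f then in_arc (x a) (x b) q else in_arc a b p)
             = (if g then in_arc (x c) (x d) q else in_arc c d p).
  have := E p q; rewrite !chain2_same //.
  by do 2 case: (if _ then _ else _).
case: f g E => [] [] E.
- by have [/perm_inj -> /perm_inj ->] := in_arc_inj xab xcd (E a).
- by have := E d (x a); rewrite in_arcl // in_arcr.
- by have := E b (x c); rewrite in_arcl // in_arcr.
- exact: in_arc_inj ab cd (fun p => E p (x a)).
Qed.

(** ** Rectangles on disjoint pairs of columns *)

Lemma chain2_disjoint x e1 e2 p q :
    disjoint_pairs e1 e2 ->
  chain2 x e1 e2 p q = chain x e1 p q + chain x e2 p q.
Proof.
case/and4P=> h11 h12 h21 h22.
by rewrite /chain2 /chain !pcompE /swap !tpermD.
Qed.

(** Reversing one of the two rectangles changes the multiplicity at the corner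
    of that rectangle.  Reversing both subtracts the sum of the indicators of
    the four arcs, minus 2; this function vanishes only if the arcs of columns
    are complementary, which would make a and d equal. *)
Lemma chain_pair_inj x a b c d f g : a != b -> c != d -> a != d ->
  (forall p q, chain x (a, b) p q + chain x (c, d) p q
             = chain x (orient f a b) p q + chain x (orient g c d) p q) ->
  f = false /\ g = false.
Proof.
move=> ab cd ad E.
have xab : x a != x b by rewrite (inj_eq perm_inj).
have xcd : x c != x d by rewrite (inj_eq perm_inj).
have {}E p q :
    in_arc a b p && in_arc (x a) (x b) q + in_arc c d p && in_arc (x c) (x d) q
    = (f (+) in_arc a b p) && (f (+) in_arc (x a) (x b) q)
      + (g (+) in_arc c d p) && (g (+) in_arc (x c) (x d) q) :> nat.
  by have := E p q; rewrite !chain_orient.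
case: f g E => [] [] E //.
- have /eqP := ad; case; suff [] : a = d /\ b = c by [].
  apply: in_arc_compl => // p.
  have := (E p (x a), E a (x a), E b (x a)); rewrite !in_arcl // !in_arcr.
  by case: (in_arc a b p) (in_arc c d p) (in_arc c d a) (in_arc c d b)
    (in_arc (x c) (x d) (x a)) => [] [] [] [] [] [] [].
- have := E a (x a); rewrite !in_arcl //.
  by case: (in_arc c d a) (in_arc (x c) (x d) (x a)) => [] [].
- have := E c (x c); rewrite !in_arcl //.
  by case: (in_arc a b c) (in_arc (x a) (x b) (x c)) => [] [].
Qed.

(** ** Rectangles on two pairs of columns with a common column *)

Lemma chain2_path x a b c f g p q : a != b -> b != c -> c != a ->
  chain2 x (orient f a b) (orient g b c) p q
  = ((f (+) in_arc a b p) && (f (+) in_arc (x a) (x b) q))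
    + ((g (+) in_arc b c p) && (g (+) ~~ in_arc (x c) (x a) q)).
Proof.
move=> ab bc ca; rewrite /chain2 !chain_orient // !pcompE swap_orient tpermR.
by rewrite tpermD 1?(eq_sym a) // 1?(in_arcC _ (_ : x c != x a)) // (inj_eq perm_inj).
Qed.

(** The arcs of a triangle at its vertices depend only on the cyclic order o of
    the three points. *)
Lemma in_arc_triangle a b c : a != b -> b != c -> c != a ->
  exists o : bool,
  [/\ (in_arc a b a, in_arc a b b, in_arc a b c) = (true, false, o),
      (in_arc b c a, in_arc b c b, in_arc b c c) = (o, true, false)
    & (in_arc c a a, in_arc c a b, in_arc c a c) = (false, o, true)].
Proof.
move=> ab bc ca; exists (in_arc a b c).
by rewrite !in_arcl // !in_arcr (in_arc_rot ab bc ca) -(in_arc_rot ca ab bc).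
Qed.

(** The 2-chains are evaluated at the nine points of the grid with columns a, b,
    c and rows x a, x b, x c.  The values depend on the four orientations and
    on the two cyclic orders only, which leaves finitely many cases. *)
Lemma chain2_path_rot x a b c f1 f2 g1 g2 :
    a != b -> b != c -> c != a ->
  (forall p q, chain2 x (orient f1 a b) (orient f2 b c) p q
             = chain2 x (orient g1 b c) (orient g2 c a) p q) ->
  f1 (+) f2 = ~~ (g1 (+) g2).
Proof.
move=> ab bc ca E.
have {}E p q := E p q.
have := (E a (x a), E a (x b), E a (x c), E b (x a), E b (x b), E b (x c),
         E c (x a), E c (x b), E c (x c)).
rewrite !chain2_path //.
have [o [[-> -> ->] [-> -> ->] [-> -> ->]]] := in_arc_triangle ab bc ca.
have [||| o' [[-> -> ->] [-> -> ->] [-> -> ->]]] :=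
  @in_arc_triangle (x a) (x b) (x c); rewrite ?(inj_eq perm_inj) //.
by case: f1 f2 g1 g2 o o' {E} => [] [] [] [] [] [] [[[[[[[[]]]]]]]].
Qed.

Lemma chain2_path_inj x a b c f1 f2 g1 g2 :
    a != b -> b != c -> c != a ->
  (forall p q, chain2 x (orient f1 a b) (orient f2 b c) p q
             = chain2 x (orient g1 a b) (orient g2 b c) p q) ->
  f1 = g1.
Proof.
move=> ab bc ca E.
have := (E a (x a), E a (x b), E a (x c), E b (x a), E b (x b), E b (x c),
         E c (x a), E c (x b), E c (x c)).
rewrite !chain2_path //.
have [o [[-> -> ->] [-> -> ->] _]] := in_arc_triangle ab bc ca.
have [||| o' [[-> -> ->] _ [-> -> ->]]] :=
  @in_arc_triangle (x a) (x b) (x c); rewrite ?(inj_eq perm_inj) //.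
by case: f1 f2 g1 g2 o o' {E} => [] [] [] [] [] [] [[[[[[[[]]]]]]]].
Qed.

End Squares.

(** * Products of two transpositions *)

Section Factorizations.
Variable n : nat.
Local Notation z := (spin_z n).
Implicit Types (a b c d i j k l m p q : 'I_n) (e : 'I_n * 'I_n) (x y : 'S_n).
Implicit Types f g : bool.

Lemma swap_same f e m : swap e (swap (orient f e.1 e.2) m) = m.
Proof. by rewrite swap_orient tpermK. Qed.

Lemma swap_path a b c f g m : a != b -> b != c -> c != a ->
  swap (orient f a b) (swap (orient g b c) m)
  = if m == a then b else if m == b then c else if m == c then a else m.
Proof.
move=> ab bc ca; rewrite !swap_orient.
have [->|ma] := eqVneq m a; first by rewrite (@tpermD _ b c) 1?eq_sym ?tpermL // eq_sym.
have [->|mb] := eqVneq m b; first by rewrite tpermL tpermD // eq_sym.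
have [->|mc] := eqVneq m c; first by rewrite !tpermR.
by rewrite (@tpermD _ b c) 1?eq_sym // tpermD // eq_sym.
Qed.

Lemma swap_disjoint e1 e2 m : disjoint_pairs e1 e2 ->
  swap e1 (swap e2 m)
  = if m == e1.1 then e1.2 else if m == e1.2 then e1.1 else
    if m == e2.1 then e2.2 else if m == e2.2 then e2.1 else m.
Proof.
case: e1 e2 => [i j] [k l] /and4P[/= ik il jk jl]; rewrite /swap /=.
have [->|mi] := eqVneq m i; first by rewrite (@tpermD _ k l) 1?eq_sym // tpermL.
have [->|mj] := eqVneq m j; first by rewrite (@tpermD _ k l) 1?eq_sym // tpermR.
have [->|mk] := eqVneq m k; first by rewrite tpermL tpermD.
have [->|ml] := eqVneq m l; first by rewrite tpermR tpermD.
by rewrite (@tpermD _ k l) 1?eq_sym // tpermD // eq_sym.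
Qed.

(** The middle vertex b' may be any of the three points moved by the 3-cycle;
    the image of b' and its preimage then are c' and a'. *)
Lemma path_rot a b c a' b' c' f g f' g' :
    a != b -> b != c -> c != a -> a' != b' -> b' != c' -> c' != a' ->
  (forall m, swap (orient f a b) (swap (orient g b c) m)
           = swap (orient f' a' b') (swap (orient g' b' c') m)) ->
  [\/ (a', b', c') = (a, b, c), (a', b', c') = (b, c, a)
    | (a', b', c') = (c, a, b)].
Proof.
move=> ab bc ca ab' bc' ca' E.
have := E b'; have := E c'.
have [neq_ba neq_cb neq_ac] : [/\ b == a = false, c == b = false & a == c = false].
  by rewrite (eq_sym b) (eq_sym c b) (eq_sym a c) (negPf ab) (negPf bc) (negPf ca).
rewrite !swap_path // !eqxx (negPf ca') (eq_sym b' a') (eq_sym c' b').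
rewrite (negPf ab') (negPf bc').
case: (eqVneq b' a) => [->|ba]; [|case: (eqVneq b' b) => [->|bb]; [|
  case: (eqVneq b' c) => [->|bc'' _ E'];
    last by rewrite E' eqxx in bc']].
all: move=> + E'; rewrite -E' ?neq_ba ?neq_cb ?neq_ac ?eqxx.
all: rewrite ?neq_ba ?neq_cb ?neq_ac ?eqxx ?(negPf ab) ?(negPf bc) ?(negPf ca).
all: move=> ->.
- by constructor 3.
- by constructor 1.
- by constructor 2.
Qed.

Lemma disjoint_flip e1 e2 e1' e2' : e1.1 != e1.2 -> e2.1 != e2.2 ->
    e1'.1 != e1'.2 -> e2'.1 != e2'.2 -> disjoint_pairs e1 e2 ->
    disjoint_pairs e1' e2' ->
  (forall m, swap e1 (swap e2 m) = swap e1' (swap e2' m)) ->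
  (exists f g, e1' = orient f e1.1 e1.2 /\ e2' = orient g e2.1 e2.2) \/
  (exists f g, e1' = orient f e2.1 e2.2 /\ e2' = orient g e1.1 e1.2).
Proof.
move: e1 e2 e1' e2' => [i j] [k l] [i' j'] [k' l'] /= ij kl ij' kl' D D' E.
have := E i'; have := E k'; rewrite !swap_disjoint //=.
move: D D' => /and4P[/= ik il jk jl] /and4P[/= ik' il' jk' jl'].
rewrite eqxx (eq_sym k' i') (eq_sym k' j') (negPf ik') (negPf jk') eqxx.
case: (eqVneq i' i) => [?|_] /=; last (case: (eqVneq i' j) => [?|_] /=;
  last (case: (eqVneq i' k) => [?|_] /=; last case: (eqVneq i' l) => [?|_] /=)).
all: case: (eqVneq k' i) => [?|_] /=; last (case: (eqVneq k' j) => [?|_] /=;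
  last (case: (eqVneq k' k) => [?|_] /=; last case: (eqVneq k' l) => [?|_] /=)).
all: move=> ? ?; subst.
all: try match goal with H : is_true (?u != ?u) |- _ => by rewrite eqxx in H end.
all: first [ by left; exists false, false | by left; exists false, true
           | by left; exists true, false | by left; exists true, true
           | by right; exists false, false | by right; exists false, true
           | by right; exists true, false | by right; exists true, true ].
Qed.

Lemma swap_disjointK e1 e2 m : disjoint_pairs e1 e2 ->
  swap e1 (swap e2 (swap e1 (swap e2 m))) = m.
Proof.
case: e1 e2 => [i j] [k l] /and4P[/= ik il jk jl]; rewrite /swap /=.
rewrite (inj_tperm k l _ (@perm_inj _ (tperm i j))).
by rewrite (tpermD ik jk) (tpermD il jl) !tpermK.
Qed.

Lemma tau_path a b c f g : a != b -> b != c ->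
  tau (orient f a b) * tau (orient g b c)
  = z ^+ (f (+) g) * (spin_tau a b * spin_tau b c).
Proof.
move=> ab bc; rewrite !tau_orient // -zexpD -!mulgA; congr (_ * _).
by rewrite mulgA -zexpC -mulgA.
Qed.

Lemma zexp_negb f : z ^+ (~~ f) = z * z ^+ f.
Proof. by case: f; rewrite /= ?expg1 ?expg0 ?mulg1 ?spin_z2. Qed.

(** Pairs of different types are told apart by their permutation: the identity,
    a product of two disjoint transpositions, a 3-cycle. *)
Lemma square_tau x e1 e2 e1' e2' : e1.1 != e1.2 -> e2.1 != e2.2 ->
    e1'.1 != e1'.2 -> e2'.1 != e2'.2 ->
    (forall m, swap e1 (swap e2 m) = swap e1' (swap e2' m)) ->
    (forall p q, chain2 x e1 e2 p q = chain2 x e1' e2' p q) -> e1 != e1' ->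
  tau e1 * tau e2 = z * (tau e1' * tau e2').
Proof.
move=> n1 n2 n1' n2' E D /eqP e11'.
case: (pairP n1 n2) => [f e2E|dis|a b c f g e1E e2E /and3P[ab bc ca]];
case: (pairP n1' n2') => [f' e2E'|dis'|a' b' c' f' g' e1E' e2E' /and3P[ab' bc' ca']].
- case: e1' e1 D e11' n1 n1' e2E e2E' {E} => [i' j'] [i j] /= D e11' n1 n1' e2E e2E'.
  by subst; have [? ?] := chain2_same_inj n1 n1' D; subst.
- have := E e1'.1; rewrite e2E swap_same swap_disjoint // eqxx.
  by move=> e1'E; rewrite e1'E eqxx in n1'.
- have := E a'; rewrite e2E swap_same e1E' e2E' swap_path // eqxx.
  by move=> e1'E; rewrite {1}e1'E eqxx in ab'.
- have := E e1.1; rewrite e2E' swap_same swap_disjoint // eqxx.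
  by move=> e1'E; rewrite e1'E eqxx in n1.
- have [[f [g [e1E e2E]]]|[f [g [e1E e2E]]]] := disjoint_flip n1 n2 n1' n2' dis dis' E.
    case/and4P: (dis) => _ d12 _ _.
    have [|f0 _] := @chain_pair_inj _ x _ _ _ _ f g n1 n2 d12.
      move=> p q; have := D p q.
      by rewrite !chain2_disjoint // e1E e2E -!surjective_pairing.
    by case: e11'; rewrite e1E f0 /= -surjective_pairing.
  case/and4P: (dis) => d11 d12 d21 d22.
  have [|g0 f0] := @chain_pair_inj _ x _ _ _ _ g f n1 n2 d12.
    move=> p q; have := D p q; rewrite !chain2_disjoint // e1E e2E.
    by rewrite -!surjective_pairing => ->; rewrite addnC.
  rewrite e1E e2E g0 f0 /tau /=; exact: spin_tau_disjoint.
- have := swap_disjointK a' dis; rewrite !E e1E' e2E' !swap_path // eqxx /=.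
  rewrite (eq_sym b') (negPf ab') eqxx => ca''; by rewrite ca'' eqxx in ca'.
- have := E a; rewrite e2E' swap_same e1E e2E swap_path // eqxx.
  by move=> bE; rewrite bE eqxx in ab.
- have := swap_disjointK a dis'; rewrite -!E e1E e2E !swap_path // eqxx /=.
  rewrite (eq_sym b) (negPf ab) eqxx => ca''; by rewrite ca'' eqxx in ca.
rewrite e1E e2E e1E' e2E' in D E e11' *.
have [] := path_rot ab bc ca ab' bc' ca' E => -[? ? ?]; subst.
- by case: e11'; rewrite (chain2_path_inj ab bc ca D).
- rewrite !tau_path // (chain2_path_rot ab bc ca D) zexp_negb -mulgA.
  by rewrite (spin_tau_rot bc ca ab).
- rewrite !tau_path // (chain2_path_rot ab' bc' ca' (fun p q => esym (D p q))).
  by rewrite zexp_negb -mulgA spin_zK (spin_tau_rot ab bc ca).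
Qed.

Lemma nat_of_bool_inj : injective nat_of_bool.
Proof. by do 2 case. Qed.

(** The first rectangle misses the row x e1.2, where the strip must then be
    filled by the second one: its columns are those of the strip.  The row
    y e2.2, with y the intermediate permutation, gives the same for the first
    rectangle. *)
Lemma column_strip x e1 e2 a b : e1.1 != e1.2 -> e2.1 != e2.2 -> a != b ->
  (forall p q, chain2 x e1 e2 p q = in_arc a b p) -> e2 = e1.
Proof.
rewrite /chain2; set y := pcomp _ _ => n1 n2 ab E.
have E1 p : in_arc e2.1 e2.2 p && in_arc (y e2.1) (y e2.2) (x e1.2) = in_arc a b p.
  have := E p (x e1.2); rewrite /chain in_arcr andbF add0n.
  exact: nat_of_bool_inj.
have E2 p : in_arc e1.1 e1.2 p && in_arc (x e1.1) (x e1.2) (y e2.2) = in_arc a b p.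
  have := E p (y e2.2); rewrite /chain in_arcr andbF addn0.
  exact: nat_of_bool_inj.
have /andP[_ r1] : in_arc e2.1 e2.2 a && in_arc (y e2.1) (y e2.2) (x e1.2).
  by rewrite E1 in_arcl.
have /andP[_ r2] : in_arc e1.1 e1.2 a && in_arc (x e1.1) (x e1.2) (y e2.2).
  by rewrite E2 in_arcl.
have [] : e2.1 = e1.1 /\ e2.2 = e1.2.
  by apply: in_arc_inj => // k; move: (E1 k) (E2 k); rewrite r1 r2 !andbT => -> ->.
by case: e1 e2 {n1 n2 y E E1 E2 r1 r2} => [i j] [k l] /= -> ->.
Qed.

(** The same argument in columns gives equal rows; since the first rectangle
    exchanges the two points, equal rows mean opposite pairs of columns. *)
Lemma row_strip x e1 e2 a b : e1.1 != e1.2 -> e2.1 != e2.2 -> a != b ->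
  (forall p q, chain2 x e1 e2 p q = in_arc a b q) -> e2 = (e1.2, e1.1).
Proof.
rewrite /chain2; set y := pcomp _ _ => n1 n2 ab E.
have E1 q : in_arc e2.1 e2.2 e1.2 && in_arc (y e2.1) (y e2.2) q = in_arc a b q.
  have := E e1.2 q; rewrite /chain in_arcr add0n.
  exact: nat_of_bool_inj.
have E2 q : in_arc e1.1 e1.2 e2.2 && in_arc (x e1.1) (x e1.2) q = in_arc a b q.
  have := E e2.2 q; rewrite /chain in_arcr addn0.
  exact: nat_of_bool_inj.
have /andP[r1 _] : in_arc e2.1 e2.2 e1.2 && in_arc (y e2.1) (y e2.2) a.
  by rewrite E1 in_arcl.
have /andP[r2 _] : in_arc e1.1 e1.2 e2.2 && in_arc (x e1.1) (x e1.2) a.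
  by rewrite E2 in_arcl.
have [] : y e2.1 = x e1.1 /\ y e2.2 = x e1.2.
  apply: in_arc_inj; rewrite ?(inj_eq perm_inj) // => q.
  by move: (E1 q) (E2 q); rewrite r1 r2 /= => -> ->.
rewrite !pcompE => /perm_inj s1 /perm_inj s2.
have -> : e2 = (swap e1 (swap e1 e2.1), swap e1 (swap e1 e2.2)).
  by rewrite !tpermK -surjective_pairing.
by rewrite s1 s2 tpermL tpermR.
Qed.

End Factorizations.

(** * The axioms of a sign assignment *)

Section SignAxioms.
Variable n : nat.
Local Notation z := (spin_z n).
Implicit Types r : rect n.

Definition redge r : 'I_n * 'I_n := (val r).2.

Lemma juxt_signP r1 r2 : juxtaposable r1 r2 ->
  is_sign (grid_sign r1 * grid_sign r2)%R /\
  sec (rsrc r1) * (tau (redge r1) * tau (redge r2))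
  = sign_spin n (grid_sign r1 * grid_sign r2)%R * sec (rtgt r2).
Proof.
move=> j12; have [s1 E1] := grid_signP r1; have [s2 E2] := grid_signP r2.
split; first exact: is_signM.
by rewrite sign_spinM // mulgA E1 -mulgA j12 E2 mulgA.
Qed.

Lemma juxt_chain r1 r2 p q : juxtaposable r1 r2 ->
  (juxt r1 r2).2 (p, q) = chain2 (rsrc r1) (redge r1) (redge r2) p q.
Proof.
by move=> j12; rewrite /juxt /= !ffunE /chain2 /chain -[pcomp _ _]/(rtgt r1) j12.
Qed.

Lemma juxt_tgt r1 r2 : juxtaposable r1 r2 ->
  rtgt r2 = pcomp (pcomp (rsrc r1) (swap (redge r1))) (swap (redge r2)).
Proof. by rewrite /juxtaposable {2}/rtgt => <-. Qed.

Lemma signN s : is_sign s -> is_sign (- s)%R /\ sign_spin n (- s)%R = z * sign_spin n s.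
Proof.
rewrite !sign_spinE => -[] ->; rewrite ?opprK /= ?expg1 ?expg0 ?mulg1 ?spin_z2.
  by split=> //; right.
by split=> //; left.
Qed.

Lemma square_axiom r1 r2 r1' r2' : juxtaposable r1 r2 -> juxtaposable r1' r2' ->
    uniq [:: r1; r2; r1'; r2'] -> juxt r1 r2 = juxt r1' r2' ->
  (grid_sign r1 * grid_sign r2 = - (grid_sign r1' * grid_sign r2'))%R.
Proof.
move=> j j' /= /andP[+ _] D; rewrite !inE !negb_or => /and3P[_ neq_r _].
have [src tgt] : rsrc r1 = rsrc r1' /\ rtgt r2 = rtgt r2' by case: D.
have [sgn E] := juxt_signP j; have [sgn' E'] := juxt_signP j'.
have [sgnN signN_E] := signN sgn'; apply: (@sign_spin_inj n) => //.
apply: (mulIg (sec (rtgt r2))).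
rewrite -E signN_E -mulgA tgt -E' -src -spin_zCA; congr (_ * _).
apply: (@square_tau _ (rsrc r1)); rewrite ?rect_neq //.
- move=> m; apply: (@perm_inj _ (rsrc r1)).
  by rewrite -!pcompE -(juxt_tgt j) tgt (juxt_tgt j') src.
- by move=> p q; rewrite -(juxt_chain p q j) D (juxt_chain p q j') src.
apply: contraNneq neq_r => edge; apply/eqP/val_inj.
by rewrite [LHS]surjective_pairing [RHS]surjective_pairing; congr (_, _).
Qed.

Lemma vertical_axiom r1 r2 : juxtaposable r1 r2 ->
  vertical_annulus (juxt r1 r2) -> (grid_sign r1 * grid_sign r2 = -1)%R.
Proof.
move=> j [a [b [ab D]]]; have [sgn E] := juxt_signP j.
have e21 : redge r2 = redge r1.
  apply: (@column_strip _ (rsrc r1) _ _ a b) => //; try exact: rect_neq.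
  by move=> p q; rewrite -(juxt_chain p q j) D ffunE.
have tgt : rtgt r2 = rsrc r1 by rewrite (juxt_tgt j) e21 -pcompA /pcomp tperm2 mul1g.
apply: (@sign_spin_inj n) => //; first by right.
apply: (mulIg (sec (rtgt r2))); rewrite -E e21 tgt sign_spinE expg1 /tau.
by rewrite spin_tau_sq ?spin_zC // rect_neq.
Qed.

Lemma horizontal_axiom r1 r2 : juxtaposable r1 r2 ->
  horizontal_annulus (juxt r1 r2) -> (grid_sign r1 * grid_sign r2 = 1)%R.
Proof.
move=> j [a [b [ab D]]]; have [sgn E] := juxt_signP j.
have e21 : redge r2 = ((redge r1).2, (redge r1).1).
  apply: (@row_strip _ (rsrc r1) _ _ a b) => //; try exact: rect_neq.
  by move=> p q; rewrite -(juxt_chain p q j) D ffunE.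
have tgt : rtgt r2 = rsrc r1.
  by rewrite (juxt_tgt j) e21 -pcompA /pcomp /swap /= tpermC tperm2 mul1g.
apply: (@sign_spin_inj n) => //; first by left.
apply: (mulIg (sec (rtgt r2))); rewrite -E e21 tgt sign_spinE expg0 /tau /=.
have n1 : (redge r1).1 != (redge r1).2 := rect_neq r1.
by rewrite (spin_tauC n1) spin_zCA spin_tau_sq // spin_z2 mulg1 mul1g.
Qed.

End SignAxioms.

Theorem lemma5p2 (n : nat) :
  (forall r : rect n,
     (sec (rsrc r) * spin_tau (rleft r) (rright r))%g
       = (sign_spin n (grid_sign r) * sec (rtgt r))%g)
  /\ sign_assignment (@grid_sign n).
Proof.
split=> [r|]; first by case: (grid_signP r).
split=> [r||r1 r2|r1 r2].
- by case: (grid_signP r).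
- exact: square_axiom.
- exact: vertical_axiom.
- exact: horizontal_axiom.
Qed.
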